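(* Let $H$ and $U$ be Hilbert spaces, let $L: U \to H$ be a bounded linear operator, set $\Gamma = LL^*$, and let $\pi: H \to H_0$ be an orthogonal projector onto a finite-dimensional subspace $H_0 \subset H$. Then for any $h \in H$ the following equivalence holds: for every $\varepsilon > 0$ there exists $u \in U$ such that $$\|Lu - h\| < \varepsilon \quad \text{and} \quad \pi(Lu) = \pi h$$ if and only if $$\lim_{\alpha \to 0^+} \alpha\,(\alpha(I-\pi) + \Gamma)^{-1} h = 0.$$
   Context: $L^*: H \to U$ denotes the Hilbert space adjoint of $L$, and $I$ is the identity operator on $H$. The projector $\pi$ is also regarded as an operator $H \to H$ via the inclusion $H_0 \subset H$. For $\alpha > 0$, $(\alpha(I-\pi)+\Gamma)^{-1}$ denotes the inverse of the bounded operator $\alpha(I-\pi)+\Gamma : H \to H$. The limit is taken in $H$.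
   Formalization: The invertibility of α(I−π)+Γ for every α>0 is added as a hypothesis; it can fail (e.g. L=0, H_0≠0), leaving the right-hand side undefined, and it holds exactly when H_0 ∩ ker L* = 0. *)

(* Defs.v *)
(* MathComp-Analysis *)
From HB Require Import structures.
From mathcomp Require Import all_boot all_order all_algebra.
From mathcomp Require Import complex.
From mathcomp Require Import all_classical all_reals all_analysis.

Set Implicit Arguments.
Unset Strict Implicit.
Unset Printing Implicit Defensive.

Import Order.TTheory GRing.Theory Num.Theory.
Import numFieldNormedType.Exports.

Local Open Scope classical_set_scope.
Local Open Scope ring_scope.
Local Open Scope complex_scope.

(* The scalar field is R or R[i], with its conjugation. On R[i] the order is
   the partial one for which [0 < a] says that a is a positive real. *)
Variant real_or_complex (R : realType) :
    forall K : numFieldType, (K -> K) -> Prop :=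
| RealScalars : @real_or_complex R R idfun
| ComplexScalars : @real_or_complex R R[i] (@conjc R).

(* [{dot H for theta}]: positive definite, linear in the first argument and
   theta-semilinear in the second. *)
HB.mixin Record CompleteNormedModule_isHilbert (K : numFieldType)
    (theta : K -> K) H & CompleteNormedModule K H := {
  dotp : {dot H for theta} ;
  sqr_norm_dotp : forall x : H, `|x| ^+ 2 = dotp x x
}.

#[short(type="hilbertType")]
HB.structure Definition Hilbert (K : numFieldType) (theta : K -> K) :=
  {H of CompleteNormedModule_isHilbert K theta H & CompleteNormedModule K H}.

Notation "''[' u , v ]" := (dotp u%R v%R) : ring_scope.

Definition bounded_operator (K : numFieldType) (V W : normedModType K)
    (f : V -> W) : Prop :=
  exists M : K, forall x : V, `|f x| <= M * `|x|.

Definition is_adjoint (K : numFieldType) (theta : K -> K)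
    (U H : hilbertType theta) (L : U -> H) (Ls : H -> U) : Prop :=
  forall (u : U) (h : H), '[L u, h] = '[u, Ls h].

Definition finite_dim_subspace (K : numFieldType) (V : lmodType K)
    (H0 : set V) : Prop :=
  exists (n : nat) (e : 'I_n -> V),
    H0 = [set \sum_(i < n) c i *: e i | c in [set: 'I_n -> K]].

Definition is_orthogonal_projector (K : numFieldType) (theta : K -> K)
    (H : hilbertType theta) (H0 : set H) (P : H -> H) : Prop :=
  forall h : H, H0 (P h) /\ forall v : H, H0 v -> '[h - P h, v] = 0.

(* Two-sided inverse when f is bijective; unspecified choice otherwise. *)
Definition inverse_operator (K : numFieldType) (V : lmodType K)
    (f : V -> V) : V -> V := 'pinv_(fun=> 0) [set: V] f.

(* a (I - P) + G *)
Definition regularized (K : numFieldType) (V : lmodType K)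
    (P G : V -> V) (a : K) : V -> V := fun x => a *: (x - P x) + G x.

(* Main.v *)
(* Let z = z(a) solve a (z - P z) + L L* z = h.  Then L L* z - h is
   - a (z - P z), which is orthogonal to H0, so P (L L* z) = P h and u = L* z
   is an admissible approximation with error at most |a z|.  Conversely, pairing
   the equation with z and using an admissible u with |L u - h| <= e gives
   a |z - P z|^2 + |L* z|^2 <= |u| |L* z| + e |z - P z|,
   which forces a (z - P z) -> 0 and a L* z -> 0.  Surjectivity of
   (I - P) + L L* then yields <a P z, v> -> 0 for every v, that is a P z -> 0
   since H0 is finite-dimensional. *)
Require Import Defs.
From mathcomp Require Import all_boot all_order all_algebra.
From mathcomp Require Import all_classical all_reals all_analysis.
From mathcomp Require complex.
From mathcomp Require Import ring.

Set Implicit Arguments.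
Unset Strict Implicit.
Unset Printing Implicit Defensive.

Import Order.TTheory GRing.Theory Num.Theory.
Import numFieldNormedType.Exports.

Local Open Scope classical_set_scope.
Local Open Scope ring_scope.

(** These two identities are all that the later sections use about the conjugation, so the real and
    complex cases are treated together. *)
Lemma conj_real_or_complex (R : realType) (K : numFieldType) (theta : K -> K) :
  real_or_complex R theta ->
  theta 0 = 0 /\ forall x, x * theta x = `|x| ^+ 2.
Proof.
case=> {K theta}; split=> //.
- by move=> x /=; rewrite -expr2 real_normK ?num_real.
- by apply/eqP; rewrite complex.eq_complex /= oppr0 !eqxx.
- by move=> x; rewrite complex.sqr_normc.
Qed.

(** * Cauchy-Schwarz and finite spanning families *)

Section InnerProduct.
Context {K : numFieldType} {theta : K -> K}.
Hypothesis theta0 : theta 0 = 0.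
Hypothesis mul_theta : forall x, x * theta x = `|x| ^+ 2.
Context {H : hilbertType theta}.
Implicit Types x y u v : H.

Lemma dotC x y : '[x, y] = theta '[y, x].
Proof. by rewrite hermitian_subproof expr0 mul1r. Qed.

Lemma dot_eq0C x y : '[x, y] = 0 -> '[y, x] = 0.
Proof. by move=> xy0; rewrite dotC xy0. Qed.

Lemma norm_dot_le u v : `|'[u, v]| <= `|u| * `|v|.
Proof.
have [->|v0] := eqVneq v 0; first by rewrite linear0r !normr0 mulr0.
set c := '[u, v]; set N := '[v, v].
have N_gt0 : 0 < N by exact: neq0_dnorm_gt0.
have thetaN : theta N = N.
  by apply: (mulfI (lt0r_neq0 N_gt0)); rewrite mul_theta ger0_norm ?ltW // expr2.
(* [w] is [N] times the component of [u] orthogonal to [v]; positivity of ['[w, w] = N * (N *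
   '[u, u] - |c|^2)] is the Cauchy-Schwarz inequality. *)
pose w := N *: u - c *: v.
have wv0 : '[w, v] = 0.
  by rewrite linearBl !linearZl_LR -/c -/N /= mulrC subrr.
have : 0 <= '[w, w] by rewrite -sqr_norm_dotp exprn_ge0.
rewrite {2}/w linearBr !linearZr_LR /= wv0 mulr0 subr0 thetaN pmulr_rge0 //.
rewrite linearBl !linearZl_LR /= (dotC v u) -/c mul_theta subr_ge0 => cN.
by rewrite -(@ler_pXn2r _ 2) ?nnegrE ?mulr_ge0 // exprMn !sqr_norm_dotp mulrC.
Qed.

Lemma cvg_dot0 (T : Type) (F : set_system T) {FF : Filter F} (f : T -> H) v :
  f t @[t --> F] --> (0 : H) -> '[f t, v] @[t --> F] --> (0 : K).
Proof.
move=> /cvgr0Pnorm_lt f0; apply/cvgr0Pnorm_lt => e e0.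
have v1 : 0 < `|v| + 1 by rewrite ltr_wpDl.
near=> t.
apply: (le_lt_trans (norm_dot_le _ _)).
have : `|f t| < e / (`|v| + 1) by near: t; apply: f0; rewrite divr_gt0.
rewrite ltr_pdivlMr //; apply: le_lt_trans.
by rewrite ler_wpM2l // lerDl.
Unshelve. all: by end_near.
Qed.

(* A right inverse of the Gram matrix on its row space turns the inner
   products with a spanning family into coordinates, without extracting a
   basis. *)
Lemma finite_dim_dual_family n (e : 'I_n -> H) :
  exists f : 'I_n -> H, forall c : 'I_n -> K,
    let x := \sum_(i < n) c i *: e i in x = \sum_(j < n) '[x, e j] *: f j.
Proof.
pose G : 'M[K]_n := \matrix_(i, j) '[e i, e j].
pose M := pinvmx G.
exists (fun j => \sum_(i < n) M j i *: e i) => c x.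
pose cr : 'rV[K]_n := \row_i c i.
pose b : 'rV[K]_n := \row_j '[x, e j].
have dotE (d : 'rV[K]_n) j : '[\sum_(i < n) d 0 i *: e i, e j] = (d *m G) 0 j.
  rewrite linear_sumlz mxE; apply: eq_bigr => i _.
  by rewrite linearZl_LR mxE.
have bj j : b 0 j = '[x, e j] by rewrite mxE.
have xE : x = \sum_(i < n) cr 0 i *: e i.
  by apply: eq_bigr => i _; rewrite mxE.
have bE : b = cr *m G by apply/rowP => j; rewrite mxE xE dotE.
have bMG : b *m M *m G = b by apply: mulmxKpV; rewrite bE submxMl.
have -> : \sum_(j < n) '[x, e j] *: (\sum_(i < n) M j i *: e i) =
          \sum_(i < n) (b *m M) 0 i *: e i.
  under eq_bigr do rewrite scaler_sumr.
  rewrite exchange_big /=; apply: eq_bigr => i _.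
  by rewrite mxE scaler_suml; apply: eq_bigr => j _; rewrite scalerA bj.
apply/eqP; rewrite -subr_eq0 {1}xE -sumrB; apply/eqP.
under eq_bigr do rewrite -scalerBl.
(* The error [y] lies in the span of the [e j] and is orthogonal to each of them, hence to
   itself. *)
set y := \sum_(i < n) _.
have yE : y = \sum_(i < n) (cr - b *m M) 0 i *: e i.
  by apply: eq_bigr => i _; rewrite !mxE.
have ye j : '[y, e j] = 0.
  by rewrite yE dotE mulmxBl bMG bE subrr mxE.
have yy : '[y, y] = 0.
  rewrite {2}yE linear_sumr big1 // => i _.
  by rewrite linearZr_LR /= ye mulr0.
have [//|y0] := eqVneq y 0.
by have := neq0_dnorm_gt0 (s := dotp) y y0; rewrite yy ltxx.
Qed.

End InnerProduct.

(** * Scalar consequence of the energy inequality *)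

(** For small [a], the last hypothesis times [a] is a quadratic inequality violated by [a * y > 2e],
    and then by [a * q > e]. In use, [u], [y], [q] are the norms of [u], [z - P z], [Ls z]. *)
Lemma regularized_error_le (K : numFieldType) (a u e y q : K) :
    0 < a -> 0 <= u -> 0 < e -> 0 <= y -> 0 <= q ->
    a * u ^+ 2 <= e ^+ 2 -> a * (u + e) <= e ->
    a * y ^+ 2 + q ^+ 2 <= u * q + e * y ->
  a * y <= e *+ 2 /\ a * q <= e *+ 2.
Proof.
move=> a0 u0 e0 y0 q0 hau hae hyq.
have [a0' e0'] := (ltW a0, ltW e0).
(* The order of [K] may be partial: comparing two elements requires knowing that they are real. *)
have realM (b c : K) : 0 <= b -> 0 <= c -> b * c \is Num.real.
  by move=> b0 c0; rewrite ger0_real ?mulr_ge0.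
have e2real : e *+ 2 \is Num.real by rewrite ger0_real ?mulrn_wge0.
have sqr_ge0 (b : K) : b \is Num.real -> 0 <= b ^+ 2.
  by move=> ?; rewrite real_exprn_even_ge0.
have uqreal : u - q \is Num.real by rewrite realB ?ger0_real.
have hY : (a * y) * (a * y - e) <= a * (u * q - q ^+ 2).
  rewrite -subr_ge0.
  have -> : a * (u * q - q ^+ 2) - a * y * (a * y - e) =
    a * (u * q + e * y - (a * y ^+ 2 + q ^+ 2)) by ring.
  by rewrite mulr_ge0 ?subr_ge0.
split.
- have [//|lt2e] := real_leP (realM _ _ a0' y0) e2real.
  have uq : u * q - q ^+ 2 <= u ^+ 2.
    rewrite -subr_ge0 -(pmulr_rge0 _ (ltr0n K 2)).
    have -> : 2%:R * (u ^+ 2 - (u * q - q ^+ 2)) =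
      (u - q) ^+ 2 + u ^+ 2 + q ^+ 2 by ring.
    by rewrite !addr_ge0 ?(sqr_ge0 _ uqreal) ?exprn_ge0.
  have : (a * y) * (a * y - e) <= e ^+ 2.
    by apply: (le_trans hY); apply: le_trans hau; rewrite ler_wpM2l.
  have : e ^+ 2 < (a * y) * (a * y - e).
    rewrite expr2; apply: ltr_pM => //; last by rewrite ltrBrDr -mulr2n.
    by apply: le_lt_trans lt2e; rewrite mulr2n lerDl.
  by move=> /lt_le_trans h /h; rewrite ltxx.
- have [|lte] := real_leP (realM _ _ a0' q0) (ger0_real e0').
    by move=> h; apply: (le_trans h); rewrite mulr2n lerDl.
  have aq0 : 0 < a * q by exact: lt_trans lte.
  have ayreal : a * y - e \is Num.real by rewrite realB ?realM ?ger0_real.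
  (* Y (e - Y) <= e ^ 2 with Y = a y, since e ^ 2 - Y e + Y ^ 2 >= 0 *)
  have hY2 : a * y * (e - a * y) <= e ^+ 2.
    rewrite -subr_ge0 -(pmulr_rge0 _ (ltr0n K 2)).
    have -> : 2%:R * (e ^+ 2 - a * y * (e - a * y)) =
      (a * y - e) ^+ 2 + (a * y) ^+ 2 + e ^+ 2 by ring.
    by rewrite !addr_ge0 ?(sqr_ge0 _ ayreal) ?exprn_ge0 ?mulr_ge0.
  have h1 : (a * q) ^+ 2 <= a * (u * (a * q) + e ^+ 2).
    rewrite -subr_ge0.
    have -> : a * (u * (a * q) + e ^+ 2) - (a * q) ^+ 2 =
      a * (a * (u * q - q ^+ 2) - (a * y) * (a * y - e)) +
      a * (e ^+ 2 - a * y * (e - a * y)) by ring.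
    by rewrite addr_ge0 // mulr_ge0 // subr_ge0.
  (* Since [e < a * q], the term [e ^+ 2] is at most [e * (a * q)]. *)
  have h2 : (a * q) ^+ 2 <= a * (u + e) * (a * q).
    apply: (le_trans h1); rewrite -mulrA ler_wpM2l // mulrDl lerD2l expr2.
    by rewrite ler_wpM2l // ltW.
  have : a * q <= a * (u + e) by rewrite -(ler_pM2r aq0) -expr2.
  by move=> /le_trans/(_ hae) /(lt_le_trans lte); rewrite ltxx.
Qed.

Lemma inverse_operatorK (K : numFieldType) (V : lmodType K) (f : V -> V) :
  bijective f -> cancel (inverse_operator f) f.
Proof.
by case=> g _ gK x; apply: pinvK; apply/mem_set; exists (g x).
Qed.

(** * Orthogonal projectors *)

Section OrthogonalProjector.
Context {K : numFieldType} {theta : K -> K}.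
Hypothesis theta0 : theta 0 = 0.
Hypothesis mul_theta : forall x, x * theta x = `|x| ^+ 2.
Context {H : hilbertType theta} {H0 : set H}.
Hypothesis hH0 : finite_dim_subspace H0.
Context {P : H -> H}.
Hypothesis hP : is_orthogonal_projector H0 P.
Implicit Types x y z v : H.

Lemma finite_dim_subspaceB x y : H0 x -> H0 y -> H0 (x - y).
Proof.
case: hH0 => n [e ->] [c _ <-] [d _ <-]; exists (fun i => c i - d i) => //.
by rewrite -sumrB; apply: eq_bigr => i _; rewrite scalerBl.
Qed.

(** [P x - P y] differs from [x - y] by a vector orthogonal to [H0], and a vector of [H0] orthogonal
    to [H0] vanishes. *)
Lemma proj_eqP x y : P x = P y <-> forall v, H0 v -> '[x - y, v] = 0.
Proof.
have [Hx ox] := hP x; have [Hy oy] := hP y; split=> [xy v Hv | oxy].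
  have -> : x - y = (x - P x) - (y - P y) by rewrite xy opprB addrA subrK.
  by rewrite linearBl /= ox // oy // subrr.
have od v : H0 v -> '[P x - P y, v] = 0.
  have -> : P x - P y = - (x - P x) + ((x - y) + (y - P y)).
    by rewrite opprB !addrA !subrK.
  move=> Hv.
  by rewrite linearDl linearNl /= ox // linearDl /= oxy // oy // oppr0 !addr0.
apply/eqP; rewrite -subr_eq0.
have [//|d0] := eqVneq (P x - P y) 0.
have := neq0_dnorm_gt0 (s := dotp) _ d0.
by rewrite od ?ltxx //; exact: finite_dim_subspaceB.
Qed.

Lemma dot_sub_proj x y : (forall v, H0 v -> '[x, v] = 0) ->
  '[x, y] = '[x, y - P y].
Proof. by move=> ox; rewrite linearBr /= (ox (P y)) ?subr0 //; case: (hP y). Qed.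

Lemma sqr_norm_sub_proj x : '[x - P x, x] = `|x - P x| ^+ 2.
Proof. by rewrite sqr_norm_dotp; apply: dot_sub_proj; case: (hP x). Qed.

(** Cauchy-Schwarz applied to ['[x - P x, x] = |x - P x|^2], then cancellation of one factor. *)
Lemma norm_sub_proj_le x : `|x - P x| <= `|x|.
Proof.
have [->|d0] := eqVneq (x - P x) 0; first by rewrite normr0.
have d_gt0 : 0 < `|x - P x| by rewrite normr_gt0.
rewrite -(ler_pM2l d_gt0) -expr2 -sqr_norm_sub_proj.
rewrite -[leLHS]ger0_norm ?norm_dot_le //.
by rewrite sqr_norm_sub_proj exprn_ge0.
Qed.

(** * The regularized equation and its limit *)

Section Regularization.
Context {U : hilbertType theta} {L : {linear U -> H}} {Ls : H -> U}.
Hypothesis hLs : is_adjoint L Ls.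
Local Notation T := (regularized P (L \o Ls)).
Hypothesis hinv : forall a : K, 0 < a -> bijective (T a).
Variable h : H.
Local Notation z a := (inverse_operator (T a) h).

Lemma regularized_inverseE a : 0 < a ->
  a *: (z a - P (z a)) + L (Ls (z a)) = h.
Proof. by move=> a0; exact: (inverse_operatorK (hinv a0) h). Qed.

Lemma regularized_residual a : 0 < a ->
  L (Ls (z a)) - h = - (a *: (z a - P (z a))).
Proof.
move=> /regularized_inverseE E.
by rewrite -[X in _ - X]E opprD addrCA subrr addr0.
Qed.

Lemma proj_regularized a : 0 < a -> P (L (Ls (z a))) = P h.
Proof.
move=> a0; apply/proj_eqP => v Hv; rewrite regularized_residual //.
by rewrite linearNl linearZl_LR /= (proj2 (hP _)) // mulr0 oppr0.
Qed.

Lemma regularized_energy_le a u e : 0 < a -> P (L u) = P h ->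
  `|L u - h| <= e ->
  a * `|z a - P (z a)| ^+ 2 + `|Ls (z a)| ^+ 2 <=
    `|u| * `|Ls (z a)| + e * `|z a - P (z a)|.
Proof.
move=> a0 /proj_eqP ouh Le; set x := z a.
(* Both sides equal ['[h, x]]: the left by pairing the equation with [x], the right because
   [L u - h] is orthogonal to [H0]. *)
have E : a * `|x - P x| ^+ 2 + `|Ls x| ^+ 2 =
    '[u, Ls x] - '[L u - h, x - P x].
  rewrite -sqr_norm_sub_proj sqr_norm_dotp -!hLs -dot_sub_proj // -linearBl.
  rewrite -linearZl_LR /= -linearDl regularized_inverseE //.
  by rewrite opprB addrC subrK.
have e0 : 0 <= a * `|x - P x| ^+ 2 + `|Ls x| ^+ 2.
  by rewrite addr_ge0 ?mulr_ge0 ?exprn_ge0 // ltW.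
rewrite -(ger0_norm e0) E; apply: (le_trans (ler_normB _ _)).
apply: lerD; first exact: norm_dot_le.
by apply: (le_trans (norm_dot_le mul_theta _ _)) => //; rewrite ler_wpM2r.
Qed.

Hypothesis approx : forall e : K, 0 < e ->
  exists u : U, `|L u - h| < e /\ P (L u) = P h.

Lemma cvg_regularized_components :
  a *: (z a - P (z a)) @[a --> (0 : K)^'+] --> (0 : H) /\
  a *: Ls (z a) @[a --> (0 : K)^'+] --> (0 : U).
Proof.
suff main (e : K) : 0 < e -> \forall a \near (0 : K)^'+,
    `|a *: (z a - P (z a))| < e /\ `|a *: Ls (z a)| < e.
  by split; apply/cvgr0Pnorm_lt => e /main; apply: filterS => a [].
(* The scalar estimate yields [2d], which must stay strictly below [e]. *)
move=> e0; pose d := e / 3%:R.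
have d0 : 0 < d by rewrite divr_gt0.
have de : d *+ 2 < e.
  have -> : e = d *+ 3 by rewrite /d -mulr_natr divfK // pnatr_eq0.
  by rewrite [ltRHS]mulrS ltrDr.
(* [u] depends on [d] alone, so the smallness required of [a] may depend on its norm. *)
have [u [ue Pu]] := approx d0.
have u1 : 0 < `|u| ^+ 2 + 1 by rewrite ltr_wpDl ?exprn_ge0.
have ud : 0 < `|u| + d by rewrite ltr_wpDl.
near=> a.
have a0 : 0 < a by near: a; exact: nbhs_right_gt.
have au : a * `|u| ^+ 2 <= d ^+ 2.
  have : a < d ^+ 2 / (`|u| ^+ 2 + 1).
    by near: a; apply: nbhs_right_lt; rewrite divr_gt0 ?exprn_gt0.
  rewrite ltr_pdivlMr // => /ltW; apply: le_trans.
  by rewrite ler_wpM2l ?lerDl // ltW.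
have ad : a * (`|u| + d) <= d.
  have : a < d / (`|u| + d) by near: a; apply: nbhs_right_lt; rewrite divr_gt0.
  by rewrite ltr_pdivlMr // => /ltW.
have := regularized_energy_le a0 Pu (ltW ue).
move=> /(regularized_error_le a0 _ d0 _ _ au ad).
rewrite !normrZ gtr0_norm // => -[//|//|//|h1 h2].
by split; apply: le_lt_trans de.
Unshelve. all: by end_near.
Qed.

(* With [v = T 1 w], self-adjointness gives
   <P z, v> = <P z, L (Ls w)> = <Ls z, Ls w> - <z - P z, L (Ls w)>. *)
Lemma cvg_regularized_proj_dot v :
  a * '[P (z a), v] @[a --> (0 : K)^'+] --> (0 : K).
Proof.
have [cy cq] := cvg_regularized_components.
have [g _ gK] := hinv ltr01.
pose w := g v.
have E a : a * '[P (z a), v] =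
    '[a *: Ls (z a), Ls w] - '[a *: (z a - P (z a)), L (Ls w)].
  have -> : v = (w - P w) + L (Ls w) by rewrite -[LHS]gK /regularized scale1r.
  set x := z a.
  have Px0 : '[P x, w - P w] = 0.
    by apply: dot_eq0C => //; apply: (proj2 (hP w)); case: (hP x).
  have Gx : '[x, L (Ls w)] = '[Ls x, Ls w].
    by rewrite dotC hLs -dotC.
  rewrite linearDr /= Px0 add0r -/x.
  by rewrite !linearZl_LR linearBl /= Gx mulrBr opprB addrC subrK.
under eq_cvg do rewrite E.
have := cvgB (cvg_dot0 mul_theta (Ls w) cq)
             (cvg_dot0 mul_theta (L (Ls w)) cy).
by rewrite subr0; apply.
Qed.

(** In a dual family [f] fixed independently of [a], the coefficients of [a *: P (z a)] are finitely
    many scalars tending to 0. *)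
Lemma cvg_regularized_proj :
  a *: P (z a) @[a --> (0 : K)^'+] --> (0 : H).
Proof.
have [n [e H0E]] := hH0.
have [f fE] := finite_dim_dual_family e.
have E a : a *: P (z a) = \sum_(j < n) (a * '[P (z a), e j]) *: f j.
  have : H0 (P (z a)) by case: (hP (z a)).
  rewrite H0E => -[c _ xE].
  rewrite -xE {1}fE /= scaler_sumr.
  by apply: eq_bigr => j _; rewrite scalerA xE.
under eq_cvg do rewrite E.
have : \sum_(j < n) (a * '[P (z a), e j]) *: f j @[a --> (0 : K)^'+] -->
    \sum_(j < n) (0 : K) *: f j.
  apply: (cvg_big add_continuous) => j _.
  by apply: cvgZr_tmp; exact: cvg_regularized_proj_dot.
by rewrite [X in _ --> X -> _]big1 // => j _; rewrite scale0r.
Qed.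

End Regularization.
End OrthogonalProjector.

Theorem theorem4 (R : realType) (K : numFieldType) (theta : K -> K)
    (hK : real_or_complex R theta)
    (U H : hilbertType theta)
    (L : {linear U -> H}) (hL : bounded_operator L)
    (Ls : H -> U) (hLs : is_adjoint L Ls)
    (H0 : set H) (hH0 : finite_dim_subspace H0)
    (P : H -> H) (hP : is_orthogonal_projector H0 P)
    (hinv : forall a : K, 0 < a -> bijective (regularized P (L \o Ls) a))
    (h : H) :
  (forall e : K, 0 < e ->
     exists u : U, `|L u - h| < e /\ P (L u) = P h)
  <->
  a *: inverse_operator (regularized P (L \o Ls) a) h @[a --> (0 : K)^'+]
    --> (0 : H).
Proof.
have [theta0 mul_theta] := conj_real_or_complex hK.
split=> [approx | /cvgr0Pnorm_lt cz e e0].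
  have [cy _] := cvg_regularized_components mul_theta hH0 hP hLs hinv approx.
  have cp := cvg_regularized_proj theta0 mul_theta hH0 hP hLs hinv approx.
  have := cvgD cy cp; rewrite addr0 => cz.
  have E (a : K) x : a *: x = a *: (x - P x) + a *: P x.
    by rewrite -scalerDr subrK.
  under eq_cvg do rewrite E.
  exact: cz.
(* A single positive [a] with [a *: z(a)] of norm below [e] suffices. *)
have /filter_ex[a [a0 za]] : \forall a \near (0 : K)^'+, 0 < a /\
    `|a *: inverse_operator (regularized P (L \o Ls) a) h| < e.
  by apply: filterI; [exact: nbhs_right_gt | exact: cz].
exists (Ls (inverse_operator (regularized P (L \o Ls) a) h)); split.
  rewrite regularized_residual // normrN normrZ; apply: le_lt_trans za.
  by rewrite normrZ ler_wpM2l // (norm_sub_proj_le mul_theta hP).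
exact: (proj_regularized hH0 hP hinv h a0).
Qed.
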